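(* There exist a stochastic game $\mathcal G$, a property $\phi$ and a static penalty scheme $(\psi,\mathit{sta})$ for which no optimally permissive randomised multi-strategy exists; that is, the infimum of $\mathit{pen}_{sta}(\theta)$ over all randomised multi-strategies $\theta$ sound for $\phi$ is not attained by any randomised multi-strategy sound for $\phi$.
   Context: A (turn-based) stochastic game is a tuple $\mathcal{G}=\langle S_\Diamond,S_\Box,\overline{s},A,\delta\rangle$, where $S=S_\Diamond\cup S_\Box$ is a finite set of states partitioned into controller states $S_\Diamond$ and environment states $S_\Box$, $\overline{s}\in S$ is the initial state, $A$ is a finite set of actions, and $\delta:S\times A\to\mathrm{Dist}(S)$ is a partial function whose distributions have rational probabilities; $A(s)=\{a\in A\mid \delta(s,a)\text{ is defined}\}$. All strategies are memoryless: a strategy for player $\Diamond$ (resp. $\Box$) is a map $\sigma:S_\Diamond\to\mathrm{Dist}(A)$ (resp. $\pi:S_\Box\to\mathrm{Dist}(A)$) with $\sigma(s)$ supported on $A(s)$; a pair $(\sigma,\pi)$ and a state $s$ induce the standard probability measure $\Pr^{\sigma,\pi}_{\mathcal G,s}$ on infinite paths $s_0a_0s_1a_1\dots$ from $s$. A reward structure is $r:S\times A\to\mathbb{Q}_{\ge 0}$, and $E^{\sigma,\pi}_{\mathcal G,s}(r)$ is the expectation of $\sum_{j\ge 0}r(s_j,a_j)$; it is assumed that $\sup_{\sigma,\pi}E^{\sigma,\pi}_{\mathcal G,s}(r)<\infty$ for all $s$. A property is either $\mathtt{R}^r_{\bowtie b}[\mathtt{C}]$ ($\bowtie\in\{\le,\ge\}$,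 $b\in\mathbb{Q}$), satisfied under $(\sigma,\pi)$ iff $E^{\sigma,\pi}_{\mathcal G,\overline s}(r)\bowtie b$, or $\mathtt{P}_{\bowtie p}[\mathtt{F}\,g]$ ($g\subseteq S$), satisfied iff the probability of reaching $g$ from $\overline s$ is $\bowtie p$. A strategy $\sigma$ is sound for $\phi$ if $\phi$ holds under $(\sigma,\pi)$ for every $\pi$. A multi-strategy is a map $\theta:S_\Diamond\to\mathrm{Dist}(2^{A})$ with $\theta(s)(\emptyset)=0$ (sets chosen at $s$ are subsets of $A(s)$); it is deterministic if each $\theta(s)$ is Dirac, randomised in general. $\sigma$ complies with $\theta$ ($\sigma\triangleleft\theta$) if for every $s\in S_\Diamond$ and nonempty $B\subseteq A(s)$ there is $d_{s,B}\in\mathrm{Dist}(B)$ with $\sigma(s)(a)=\sum_{B\ni a}\theta(s)(B)d_{s,B}(a)$ for all $a\in A(s)$. $\theta$ is sound for $\phi$ if every $\sigma\triangleleft\theta$ is sound for $\phi$. A static penalty scheme is given by $\psi:S_\Diamond\times A\to\mathbb{Q}_{\ge0}$; the local penalty is $\mathit{pen}_{loc}(\theta,s)=\sum_{B\subseteq A(s)}\sum_{a\in A(s)\setminus B}\theta(s)(B)\psi(s,a)$ and the static penalty is $\mathit{pen}_{sta}(\theta)=\sum_{s\in S_\Diamond}\mathit{pen}_{loc}(\theta,s)$. A sound multi-strategy of a class is optimally permissive if its penalty equals the infimum of penalties over all sound multi-strategies of that class. *)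

(* Defs.v *)
From HB Require Import structures.
From mathcomp Require Import all_boot all_order all_algebra.
From mathcomp Require Import all_classical all_reals all_analysis.

Set Implicit Arguments.
Unset Strict Implicit.
Unset Printing Implicit Defensive.

Import Order.TTheory GRing.Theory Num.Theory.

Local Open Scope classical_set_scope.
Local Open Scope ring_scope.

Record fdist (R : numDomainType) (T : finType) := FDist {
  fdist_val :> T -> R;
  fdist_ge0 : forall x, 0 <= fdist_val x;
  fdist_sum1 : \sum_x fdist_val x = 1 }.

(* The partition of the states into controller and environment states is the
   sum [cstate + estate]. [nonblocking] makes strategies and infinite paths
   exist. *)
Record stochastic_game := StochasticGame {
  cstate : finType;
  estate : finType;
  act : finType;
  init : cstate + estate;
  delta : cstate + estate -> act -> option (fdist rat (cstate + estate)%type);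
  nonblocking : forall s, exists a, isSome (delta s a) }.

Definition state (G : stochastic_game) : finType := (cstate G + estate G)%type.

Definition enabled (G : stochastic_game) (s : state G) : {set act G} :=
  finset (fun a => isSome (delta s a)).

(* [owner] is the inclusion of the states of one player into all states. *)
Record strategy (R : realType) (G : stochastic_game) (T : finType)
    (owner : T -> state G) := Strategy {
  choice_of :> T -> fdist R (act G);
  choice_enabled :
    forall s a, a \notin enabled (owner s) -> choice_of s a = 0 }.

Definition cstrategy (R : realType) (G : stochastic_game) :=
  strategy R (inl : cstate G -> state G).
Definition estrategy (R : realType) (G : stochastic_game) :=
  strategy R (inr : estate G -> state G).

(* [w j] is the pair (s_j, a_j) of the path s_0 a_0 s_1 a_1 ... ; sequences
   that use undefined or zero-probability transitions are kept, as a null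
   set. *)
Definition path_of (G : stochastic_game) := nat -> (state G * act G)%type.

HB.instance Definition _ (G : stochastic_game) := Choice.on (path_of G).
HB.instance Definition _ (G : stochastic_game) := isPointed.Build (path_of G)
  (fun=> (init G, xchoose (nonblocking (init G)))).

Section paths.
Variables (R : realType) (G : stochastic_game).

(* The paths with the same finite prefix s_0 a_0 ... a_(n-1) s_n as [w]. *)
Definition cylinder (w : path_of G) (n : nat) : set (path_of G) :=
  [set v | (forall i, (i <= n)%N -> (v i).1 = (w i).1) /\
           (forall i, (i < n)%N -> (v i).2 = (w i).2)].

Definition cylinders : set (set (path_of G)) :=
  [set C | exists w n, C = cylinder w n].

Definition path_space := g_sigma_algebraType cylinders.

Definition action_prob (sigma : cstrategy R G) (pi : estrategy R G)
    (s : state G) (a : act G) : R :=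
  match s with inl x => sigma x a | inr y => pi y a end.

Definition trans_prob (s : state G) (a : act G) (t : state G) : R :=
  if delta s a is Some d then ratr (d t) else 0.

Definition is_path_measure (sigma : cstrategy R G) (pi : estrategy R G)
    (s : state G) (P : probability path_space R) : Prop :=
  forall (w : path_of G) (n : nat),
    P (cylinder w n) =
    (((w 0%N).1 == s)%:R *
     \prod_(i < n) (action_prob sigma pi (w i).1 (w i).2 *
                    trans_prob (w i).1 (w i).2 (w i.+1).1))%:E.

(* Exactly one probability satisfies [is_path_measure sigma pi s]: existence by
   the Ionescu-Tulcea theorem, uniqueness because the cylinders, together with
   the empty set, form a generating pi-system. *)
Definition path_measure (sigma : cstrategy R G) (pi : estrategy R G)
    (s : state G) : probability path_space R :=
  get (is_path_measure sigma pi s).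

End paths.

Record reward_structure (G : stochastic_game) := RewardStructure {
  reward :> state G -> act G -> rat;
  reward_ge0 : forall s a, 0 <= reward s a }.

Inductive comparison := CmpLe | CmpGe.

Definition cmp_bound (R : realType) (c : comparison) (x : \bar R) (b : rat) :
    Prop :=
  match c with
  | CmpLe => (x <= (ratr b)%:E)%E
  | CmpGe => ((ratr b)%:E <= x)%E
  end.

Inductive property (G : stochastic_game) :=
  | RewardC of reward_structure G & comparison & rat
  | ProbF of comparison & rat & {set state G}.

Section soundness.
Variables (R : realType) (G : stochastic_game).
Implicit Types (sigma : cstrategy R G) (pi : estrategy R G).

Definition expected_reward sigma pi (s : state G) (r : reward_structure G) :
    \bar R :=
  (\int[path_measure sigma pi s]_w
     \sum_(0 <= j <oo) (ratr (r (w j).1 (w j).2))%:E)%E.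

Definition reach_prob sigma pi (s : state G) (g : {set state G}) : \bar R :=
  path_measure sigma pi s [set w | exists j, (w j).1 \in g].

Definition satisfies sigma pi (phi : property G) : Prop :=
  match phi with
  | RewardC r c b => cmp_bound c (expected_reward sigma pi (init G) r) b
  | ProbF c p g => cmp_bound c (reach_prob sigma pi (init G) g) p
  end.

Definition finite_reward (r : reward_structure G) : Prop :=
  forall s : state G,
    (ereal_sup [set x | exists sigma pi, x = expected_reward sigma pi s r]
      < +oo)%E.

Definition admissible (phi : property G) : Prop :=
  match phi with
  | RewardC r _ _ => finite_reward r
  | ProbF _ p _ => 0 <= p <= 1
  end.

Definition sound_strategy (phi : property G) sigma : Prop :=
  forall pi, satisfies sigma pi phi.

(* Each value is an arbitrary distribution over nonempty sets of enabled
   actions, so these are the randomised multi-strategies. *)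
Record multi_strategy := MultiStrategy {
  mchoice :> cstate G -> fdist R {set act G};
  mchoice0 : forall s, mchoice s finset.set0 = 0;
  mchoice_enabled : forall s (B : {set act G}),
    ~~ (B \subset enabled (inl s : state G)) -> mchoice s B = 0 }.

Definition complies sigma (theta : multi_strategy) : Prop :=
  exists d : cstate G -> {set act G} -> fdist R (act G),
    (forall s (B : {set act G}), B != finset.set0 ->
       B \subset enabled (inl s : state G) ->
       forall a, a \notin B -> d s B a = 0) /\
    (forall s a, a \in enabled (inl s : state G) ->
       sigma s a =
       \sum_(B : {set act G} | (B \subset enabled (inl s : state G)) &&
                               (a \in B)) theta s B * d s B a).

Definition sound (phi : property G) (theta : multi_strategy) : Prop :=
  forall sigma, complies sigma theta -> sound_strategy phi sigma.

Record penalty_scheme := PenaltyScheme {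
  penalty :> cstate G -> act G -> rat;
  penalty_ge0 : forall s a, 0 <= penalty s a }.

Definition pen_loc (psi : penalty_scheme) (theta : multi_strategy)
    (s : cstate G) : R :=
  \sum_(B : {set act G} | B \subset enabled (inl s : state G))
    \sum_(a in enabled (inl s : state G) :\: B) theta s B * ratr (psi s a).

Definition pen_sta (psi : penalty_scheme) (theta : multi_strategy) : R :=
  \sum_(s : cstate G) pen_loc psi theta s.

Definition optimally_permissive (phi : property G) (psi : penalty_scheme)
    (theta : multi_strategy) : Prop :=
  sound phi theta /\
  pen_sta psi theta = inf [set pen_sta psi theta' | theta' in sound phi].

End soundness.

Arguments multi_strategy : clear implicits.

(* Main.v *)
(** In the game below the controller can stay in [home] (action [true]) or
    leave for the absorbing state [goal] (action [false]), and must reach [goal]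
    almost surely; forbidding [true] costs 1 and forbidding [false] is free. The
    penalty of [theta] is thus the probability that it offers only [false]. If it
    is positive, every compliant strategy leaves with a positive probability at
    each step and [theta] is sound; if it is zero, always staying is compliant and
    never reaches [goal]. So the infimum 0 is not attained.

    When leaving has probability [beta > 0], the path measure is the mixture of the
    Dirac masses at the paths [delayed k], with weights [beta * (1 - beta) ^+ k]. *)

Require Import Defs.
From mathcomp Require Import all_boot all_order all_algebra.
From mathcomp Require Import all_classical all_reals all_analysis.

Set Implicit Arguments.
Unset Strict Implicit.
Unset Printing Implicit Defensive.

Import Order.TTheory GRing.Theory Num.Theory.

Local Open Scope classical_set_scope.
Local Open Scope ring_scope.

Section finite_distributions.
Variables (R : numDomainType) (T : finType).

Lemma dirac_fdist_ge0 (x y : T) : 0 <= (y == x)%:R :> R.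
Proof. exact: ler0n. Qed.

Lemma dirac_fdist_sum1 (x : T) : \sum_y (y == x)%:R = 1 :> R.
Proof. by rewrite (bigD1 x) //= eqxx big1 ?addr0 // => y /negbTE ->. Qed.

Definition dirac_fdist (x : T) : fdist R T :=
  FDist (dirac_fdist_ge0 x) (dirac_fdist_sum1 x).

Variables (p : R) (p01 : 0 <= p <= 1) (x y : T).

Lemma mix_fdist_ge0 z : 0 <= p * (z == x)%:R + (1 - p) * (z == y)%:R.
Proof.
by case/andP: p01 => p0 p1; rewrite addr_ge0 ?mulr_ge0 ?ler0n ?subr_ge0.
Qed.

Lemma mix_fdist_sum1 : \sum_z (p * (z == x)%:R + (1 - p) * (z == y)%:R) = 1.
Proof.
by rewrite big_split /= -!mulr_sumr !dirac_fdist_sum1 !mulr1 addrC subrK.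
Qed.

Definition mix_fdist : fdist R T := FDist mix_fdist_ge0 mix_fdist_sum1.

End finite_distributions.

(** * Cylinder sets and measurability of reachability *)

Section cylinders.
Variable G : stochastic_game.
Implicit Types v w : path_of G.

Definition shift w : path_of G := fun i => w i.+1.

Lemma mem_cylinder0 v w : (v \in cylinder w 0) = ((v 0%N).1 == (w 0%N).1).
Proof.
apply/idP/eqP => [/set_mem[s_eq _]|vw]; first exact: s_eq.
by apply/mem_set; split=> // i; rewrite leqn0 => /eqP ->.
Qed.

(** A cylinder of length [n] fixes the states up to index [n] but the actions only below [n]. From
    length one on, the whole first pair is therefore fixed and can be split off; the inductions on
    [n] below rest on this. *)
Lemma mem_cylinderS v w n :
  (v \in cylinder w n.+1) =
  (v 0%N == w 0%N) && (shift v \in cylinder (shift w) n).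
Proof.
apply/idP/andP => [/set_mem[s_eq a_eq]|[/eqP vw0 /set_mem[s_eq a_eq]]].
  split; last by apply/mem_set; split=> i; [exact: (s_eq i.+1)|exact: (a_eq i.+1)].
  by apply/eqP; apply: injective_projections; [exact: s_eq|exact: a_eq].
by apply/mem_set; split=> -[|i] ?; rewrite ?vw0 //; [exact: s_eq|exact: a_eq].
Qed.

Lemma measurable_cylinder w n :
  measurable (cylinder w n : set (path_space G)).
Proof. by apply: sub_sigma_algebra; exists w, n. Qed.

(** A path meets [g] iff it lies in the cylinder of some finite prefix ending in [g], and there are
    only countably many finite prefixes. *)
Lemma measurable_reach (g : {set state G}) :
  measurable [set w : path_space G | exists j, (w j).1 \in g].
Proof.
pose c := (init G, xchoose (nonblocking (init G))) : state G * act G.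
(* A pair [(j, p)] encodes a prefix of length [j]; [p] is padded to a path by the arbitrary default
   [c]. *)
pose C (x : nat * seq (state G * act G)) : set (path_space G) :=
  if (nth c x.2 x.1).1 \in g then cylinder (nth c x.2) x.1 else set0.
rewrite (_ : [set w | _] = \bigcup_x C x).
  apply: countable_bigcupT_measurable => [|x]; first exact: countableP.
  by rewrite /C; case: ifP => // _; exact: measurable_cylinder.
apply/seteqP; split=> w /=.
  case=> j wj; exists (j, mkseq w j.+1) => //.
  rewrite /C /= nth_mkseq// wj; split=> i ij; rewrite nth_mkseq//.
  exact: ltnW.
case=> -[j p] _; rewrite /C /=; case: ifP => // pj [wp _].
by exists j; rewrite wp.
Qed.

End cylinders.

(** * Weights of finite prefixes *)

Section path_weight.
Variables (R : realType) (G : stochastic_game).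
Variables (sigma : cstrategy R G) (pi : estrategy R G).
Implicit Types (s t : state G) (a : act G) (w : path_of G).

Definition step_weight s a t := action_prob sigma pi s a * trans_prob R s a t.

Definition path_weight w n :=
  \prod_(i < n) step_weight (w i).1 (w i).2 (w i.+1).1.

Lemma path_weightS w n :
  path_weight w n.+1 =
  step_weight (w 0%N).1 (w 0%N).2 (w 1%N).1 * path_weight (shift w) n.
Proof. by rewrite /path_weight big_ord_recl. Qed.

(** If the play surely loops at [s] with action [a], the Dirac mass at the constant path has the
    cylinder values of a path measure. This serves both for staying in [home] forever and for the
    tail after arrival in [goal]. *)
Lemma mem_cylinder_cst s a w n :
  (forall b t, step_weight s b t = ((b == a) && (t == s))%:R) ->
  ((fun=> (s, a)) \in cylinder w n)%:R = ((w 0%N).1 == s)%:R * path_weight w n.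
Proof.
move=> stepE; elim: n w => [|n IH] w.
  by rewrite mem_cylinder0 /path_weight big_ord0 mulr1 eq_sym.
rewrite mem_cylinderS -mulnb natrM (IH (shift w)) path_weightS.
case: (w 0%N) => s' a' /=; rewrite xpair_eqE (eq_sym s').
case: (eqVneq s s') => [<-|_]; last by rewrite !mul0r.
by rewrite stepE mul1r mulrA -natrM mulnb eq_sym.
Qed.

End path_weight.

(** * The escape game, its path measure and its reachability probabilities *)

Section escape_game.

(** In the absorbing state only [true] is enabled, so the environment has no choice and the play
    depends on the controller alone. *)
Definition escape_delta (s : unit + unit) (a : bool) :
    option (fdist rat (unit + unit)%type) :=
  match s, a with
  | inl _, true => Some (dirac_fdist rat (inl tt))
  | inl _, false => Some (dirac_fdist rat (inr tt))
  | inr _, true => Some (dirac_fdist rat (inr tt))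
  | inr _, false => None
  end.

Lemma escape_nonblocking s : exists a, isSome (escape_delta s a).
Proof. by exists true; case: s. Qed.

Definition escape_game : stochastic_game :=
  StochasticGame (inl tt) escape_nonblocking.

Definition home : state escape_game := inl tt.
Definition goal : state escape_game := inr tt.

Variables (R : realType) (sigma : cstrategy R escape_game)
  (pi : estrategy R escape_game).

Let beta := sigma tt false.

Lemma sigma_stay : sigma tt true = 1 - beta.
Proof. by rewrite -(fdist_sum1 (sigma tt)) big_bool addrK. Qed.

Lemma step_home (a : bool) t :
  step_weight sigma pi home a t =
  if a then (1 - beta) * (t == home)%:R else beta * (t == goal)%:R.
Proof.
by rewrite /step_weight /trans_prob; case: a; rewrite /= ratr_nat ?sigma_stay.
Qed.

Lemma step_goal (a : bool) t :
  step_weight sigma pi goal a t = (a && (t == goal))%:R.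
Proof.
have pi0 : pi tt false = 0 by apply: choice_enabled; rewrite inE.
have pi1 : pi tt true = 1.
  by rewrite -(fdist_sum1 (pi tt)) big_bool /= pi0 addr0.
rewrite /step_weight /trans_prob; case: a; rewrite /= ?mulr0 //.
by rewrite ratr_nat pi1 mul1r.
Qed.

Let step_stay_forever : beta = 0 ->
  forall b t, step_weight sigma pi home b t = ((b == true) && (t == home))%:R.
Proof.
move=> beta0 b t; rewrite step_home beta0 subr0 mul0r.
by case: b; rewrite //= mul1r.
Qed.

Let step_goal_forever b t :
  step_weight sigma pi goal b t = ((b == true) && (t == goal))%:R.
Proof. by rewrite step_goal; case: b. Qed.

(** The second component is the action: [false] is played at index [k] only, and [goal] is entered
    at index [k.+1]. *)
Definition delayed k : path_of escape_game :=
  fun i => (if (i <= k)%N then home else goal, i != k).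

Lemma shift_delayed0 : shift (delayed 0) = fun=> (goal, true).
Proof. by []. Qed.

Lemma shift_delayedS k : shift (delayed k.+1) = delayed k.
Proof. by []. Qed.

Lemma path_weight_delayed k :
  path_weight sigma pi (delayed k) k.+1 = beta * (1 - beta) ^+ k.
Proof.
elim: k => [|k IH].
  rewrite path_weightS /path_weight big_ord0 step_home /=.
  by rewrite !mulr1.
rewrite path_weightS shift_delayedS IH step_home /=.
by rewrite mulr1 mulrCA exprS.
Qed.

Lemma escape_path_measure0 : beta = 0 ->
  is_path_measure sigma pi home (\d_((fun=> (home, true)) : path_space escape_game)).
Proof.
move=> /step_stay_forever stepE w n.
by rewrite -[X in X%:E](mem_cylinder_cst _ _ stepE); exact: diracE.
Qed.

Section positive_escape.
Hypothesis beta_gt0 : 0 < beta.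

Let beta_le1 : beta <= 1.
Proof.
by rewrite -(fdist_sum1 (sigma tt)) big_bool /= lerDr fdist_ge0.
Qed.

Let weight_ge0 k : 0 <= beta * (1 - beta) ^+ k.
Proof. by rewrite mulr_ge0 ?exprn_ge0 ?subr_ge0 // ltW. Qed.

Lemma escape_time_sum1 :
  (\sum_(0 <= k <oo) (beta * (1 - beta) ^+ k)%:E = 1 :> \bar R)%E.
Proof.
apply/cvg_lim => //.
rewrite (_ : (fun _ => _) = EFin \o series (geometric beta (1 - beta))); last first.
  by apply/funext => n /=; rewrite sumEFin.
apply: cvg_EFin; first exact: nearW.
have := @cvg_geometric_series R beta (1 - beta).
rewrite subKr divff ?gt_eqF //; apply.
by rewrite ger0_norm ?subr_ge0 // gtrDl oppr_lt0.
Qed.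

(** Induction on [n], conditioning on the first step: the term [k = 0] leaves at once and continues
    as the constant path in [goal], while the terms [k.+1] share a factor [1 - beta] and, after a
    shift, form the same mixture for the shifted prefix. *)
Lemma escape_mixture_cylinder w n :
  (\sum_(0 <= k <oo) ((beta * (1 - beta) ^+ k)%:E * (delayed k \in cylinder w n)%:R%:E)
   = (((w 0%N).1 == home)%:R * path_weight sigma pi w n)%:E)%E.
Proof.
elim: n w => [|n IH] w.
  under eq_eseriesr => k _ do rewrite mem_cylinder0 muleC.
  rewrite nneseriesZl => [|k _]; last by rewrite lee_fin.
  by rewrite escape_time_sum1 mule1 /path_weight big_ord0 mulr1 eq_sym.
have f_ge0 k : (0 <= (beta * (1 - beta) ^+ k)%:E *
    (delayed k \in cylinder w n.+1)%:R%:E :> \bar R)%E.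
  by rewrite mule_ge0 // lee_fin // ler0n.
rewrite nneseries_recl // -nneseries_addn //.
under eq_eseriesr => k _.
  rewrite addn1 mem_cylinderS shift_delayedS -mulnb natrM exprS mulrCA.
  rewrite (EFinM (1 - beta)) (EFinM (_ == _)%:R) muleACA -(EFinM (1 - beta)).
  rewrite [delayed k.+1 0%N](_ : _ = (home, true)) //.
  over.
rewrite nneseriesZl => [|k _]; last by rewrite mule_ge0 // lee_fin // ler0n.
rewrite IH mem_cylinderS shift_delayed0 -mulnb natrM.
rewrite (mem_cylinder_cst _ _ step_goal_forever) path_weightS -!EFinM -EFinD.
(* At most one of the two first moves, leaving or staying, matches the first transition of [w], and
   it contributes exactly the weight of that transition. *)
have stepE :
    beta * ((home, false) == w 0%N)%:R * ((w 1%N).1 == goal)%:R +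
    (1 - beta) * ((home, true) == w 0%N)%:R * ((w 1%N).1 == home)%:R =
    ((w 0%N).1 == home)%:R * step_weight sigma pi (w 0%N).1 (w 0%N).2 (w 1%N).1.
  case: (w 0%N) => -[[]|[]] [] /=;
  by rewrite ?step_home ?(mul0r, mulr0, addr0, add0r, mulr1, mul1r).
by congr EFin; rewrite [RHS]mulrA -stepE expr0 mulr1 [RHS]mulrDl !mulrA.
Qed.

Lemma escape_path_measure_gt0 :
  exists P, is_path_measure sigma pi home P.
Proof.
pose D k : {measure set (path_space escape_game) -> \bar R} :=
  mscale (NngNum (weight_ge0 k)) (\d_(delayed k : path_space escape_game)).
pose mu : {measure set (path_space escape_game) -> \bar R} := mseries D 0.
have muE A : mu A = (\sum_(0 <= k <oo)
    ((beta * (1 - beta) ^+ k)%:E * (delayed k \in A)%:R%:E))%E.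
  by apply: eq_eseriesr => k _; rewrite /= /mscale /= diracE.
have mu1 : mu setT = 1%E.
  rewrite muE -escape_time_sum1; apply: eq_eseriesr => k _.
  by rewrite in_setT mule1.
pose P0 : probability (path_space escape_game) R := \d_(delayed 0 : path_space escape_game).
(* [mu] already has mass 1: normalising it only bundles it as a probability. *)
exists (mnormalize mu P0) => w n.
rewrite /= /mnormalize mu1 onee_eq0 /= invr1 mule1.
by rewrite -escape_mixture_cylinder -muE.
Qed.

End positive_escape.

(** Since [path_measure] is picked by [get], a witness suffices: a Dirac mass if [beta = 0], the
    geometric mixture otherwise. *)
Lemma path_measureP : is_path_measure sigma pi home (path_measure sigma pi home).
Proof.
apply: getPex; have [/eqP beta0|beta_neq0] := boolP (beta == 0).
  by eexists; exact: escape_path_measure0.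
by apply: escape_path_measure_gt0; rewrite lt_def beta_neq0 fdist_ge0.
Qed.

(** A path that reaches [goal] leaves some cylinder of the constant path in [home]. Each of these
    has probability 1, so the event lies in a countable union of null sets. *)
Lemma reach_goal0 : beta = 0 ->
  reach_prob sigma pi home (finset.set1 goal) = 0%E.
Proof.
move=> /step_stay_forever stepE; rewrite /reach_prob.
pose C := cylinder (fun=> (home, true)) : nat -> set (path_space escape_game).
have mC n : measurable (C n) by exact: measurable_cylinder.
apply/negligibleP; first exact: measurable_reach.
apply: (@negligibleS _ _ _ _ (\bigcup_n ~` C n)).
  move=> w /= [j]; rewrite inE => /eqP wj; exists j => //= -[wE _].
  by have := wE j (leqnn j); rewrite wj.
have PC n : path_measure sigma pi home (C n) = 1%E.
  rewrite path_measureP; congr EFin.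
  by rewrite -[LHS](mem_cylinder_cst (fun=> (home, true)) n stepE) mem_set.
apply: negligible_bigcup => n; apply/negligibleP; first exact: measurableC.
by rewrite [LHS](probability_setC _ (mC n)) PC subee.
Qed.

(** Only the lower bound needs work: the cylinders [C k] of paths leaving at step [k] are disjoint,
    lie in the event, and have geometric probabilities that sum to 1. *)
Lemma reach_goal1 : 0 < beta ->
  reach_prob sigma pi home (finset.set1 goal) = 1%E.
Proof.
move=> beta_gt0; rewrite /reach_prob; set P := path_measure _ _ _.
have mR := measurable_reach (finset.set1 goal).
pose C k := cylinder (delayed k) k.+1 : set (path_space escape_game).
have mC n : measurable (C n) by exact: measurable_cylinder.
have mU : measurable (\bigcup_k C k) by exact: bigcup_measurable.
(* On [C k] the first [false] is played at index [k], which gives disjointness. *)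
have leave k v : C k v -> forall j, (j <= k)%N -> (v j).2 = (j != k).
  by move=> [_ vE] j jk; rewrite vE.
have tC : trivIset setT C.
  apply/trivIsetP => i j _ _ ij; apply/seteqP; split=> v // -[vi vj].
  wlog lt_ij : i j ij vi vj / (i < j)%N.
    move=> wl; case: (ltngtP i j) ij => // lt_ij _.
      by apply: (wl i j) => //; rewrite ltn_eqF.
    by apply: (wl j i) => //; rewrite ltn_eqF.
  have := leave _ _ vi i (leqnn i).
  by rewrite (leave _ _ vj i (ltnW lt_ij)) eqxx ij.
apply/eqP; rewrite eq_le probability_le1 //=.
rewrite -(escape_time_sum1 beta_gt0).
rewrite (_ : (\sum_(0 <= k <oo) _)%E = P (\bigcup_k C k)).
  apply: le_measure; rewrite ?inE // => v [k _ [vE _]]; exists k.+1.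
  by rewrite vE // inE /= ltnn.
rewrite measure_semi_bigcup //; apply: eq_eseriesr => k _.
by rewrite [RHS]path_measureP eqxx mul1r -path_weight_delayed.
Qed.

End escape_game.

(** * Penalties and soundness of multi-strategies in the escape game *)

Section escape_permissions.
Variable R : realType.

Definition almost_sure_goal : property escape_game :=
  ProbF CmpGe 1 (finset.set1 goal).

Lemma stay_penalty_ge0 (s : unit) (a : bool) : 0 <= (a%:R : rat).
Proof. exact: ler0n. Qed.

Definition stay_penalty : penalty_scheme escape_game :=
  @PenaltyScheme escape_game (fun _ a => a%:R) stay_penalty_ge0.

Lemma sub_enabled_home (B : {set bool}) :
  B \subset enabled (inl tt : state escape_game).
Proof. by apply/fintype.subsetP => -[] _; rewrite inE. Qed.

(** Only omitting [true] costs anything; the sets omitting it are [{false}] and the empty set, and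
    the latter has weight zero. *)
Lemma pen_sta_escape (theta : multi_strategy R escape_game) :
  pen_sta stay_penalty theta = theta tt [set false]%SET.
Proof.
rewrite /pen_sta (big_pred1 tt) => [|[]] //; rewrite /pen_loc.
rewrite (eq_bigl predT) => [|B]; last exact: sub_enabled_home.
rewrite (bigD1 [set false]%SET) //= (bigD1 true) ?inE //=.
rewrite big1 => [|[]]; rewrite ?inE //= ratr_nat mulr1 addr0.
rewrite big1 ?addr0 // => B B_neq.
have [->|B_neq0] := eqVneq B finset.set0.
  by rewrite big1 // => a _; rewrite mchoice0 mul0r.
rewrite big1 // => -[]; last by rewrite ratr_nat mulr0.
rewrite !inE andbT => trueB; case/finset.set0Pn: B_neq0 => -[] aB.
  by rewrite aB in trueB.
by case/eqP: B_neq; apply/finset.setP => -[]; rewrite inE ?aB // (negbTE trueB).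
Qed.

(** When only [false] is offered, a compliant strategy must play it, so it leaves with at least the
    probability of that offer. *)
Lemma sound_escape (theta : multi_strategy R escape_game) :
  0 < theta tt [set false]%SET -> sound almost_sure_goal theta.
Proof.
move=> leave_gt0 sigma [d [d_supp sigmaE]] pi.
rewrite /satisfies /= rmorph1 reach_goal1 //.
rewrite sigmaE ?inE // (bigD1 [set false]%SET) /= ?sub_enabled_home ?inE //.
have -> : d tt [set false]%SET false = 1.
  rewrite -(fdist_sum1 (d tt [set false]%SET)) big_bool /= (d_supp _ _ _ _ true) ?add0r ?inE //.
  - by apply/finset.set0Pn; exists false; rewrite inE.
  - exact: sub_enabled_home.
rewrite mulr1 ltr_wpDr // sumr_ge0 // => B _.
by rewrite mulr_ge0 ?fdist_ge0.
Qed.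

Lemma stay_enabled (T : finType) (owner : T -> state escape_game) s a :
  a \notin enabled (owner s) -> dirac_fdist R true a = 0.
Proof. by rewrite inE; case: a => //; case: (owner s). Qed.

Definition stay_strategy (T : finType) (owner : T -> state escape_game) :
    strategy R owner :=
  @Strategy R escape_game T owner (fun=> dirac_fdist R true)
    (@stay_enabled T owner).

Lemma unsound_escape (theta : multi_strategy R escape_game) :
  theta tt [set false]%SET = 0 -> ~ sound almost_sure_goal theta.
Proof.
move=> leave0 sound_theta.
have : complies (stay_strategy _) theta.
  (* The truth value of [true \in B] is itself the action chosen: [true] if it is offered, [false]
     otherwise. *)
  exists (fun _ (B : {set bool}) => dirac_fdist R (true \in B)); split.
    move=> s B B_neq0 _ a /= aB; case: eqP aB => // ->.
    case: (boolP (true \in B)) => [->//|tB] fB.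
    case/finset.set0Pn: B_neq0 => -[]; first by rewrite (negbTE tB).
    by rewrite (negbTE fB).
  move=> [] a _ /=.
  case: a; rewrite /=; last first.
    rewrite big1 // => B /andP[_ fB].
    case: (boolP (true \in B)) => [_|tB]; first by rewrite mulr0.
    rewrite (_ : B = [set false]%SET) ?leave0 ?mul0r //.
    by apply/finset.setP => -[]; rewrite inE ?fB // (negbTE tB).
  (* The value 1 is expanded as the total mass of [theta tt]; the sets without [true] carry none of
     it. *)
  rewrite -[LHS](fdist_sum1 (theta tt)) [RHS]big_mkcond; apply: eq_bigr => B _ /=.
  rewrite sub_enabled_home andTb; case: ifP => [->|tB]; first by rewrite eqxx mulr1.
  have [->|B_neq0] := eqVneq B finset.set0; first by rewrite mchoice0.
  rewrite (_ : B = [set false]%SET) ?leave0 //.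
  case/finset.set0Pn: B_neq0 => -[] aB; first by rewrite tB in aB.
  by apply/finset.setP => -[]; rewrite inE ?aB // tB.
move=> /sound_theta /(_ (stay_strategy _)); rewrite /satisfies /= rmorph1.
by rewrite reach_goal0 // lee_fin ler10.
Qed.

Lemma escape_permission0 (p : R) (p01 : 0 <= p <= 1) (s : unit) :
  mix_fdist p01 [set false]%SET [set: bool]%SET finset.set0 = 0.
Proof.
rewrite /= !(eq_sym finset.set0).
rewrite (_ : ([set false]%SET == finset.set0) = false); last first.
  by apply/negbTE/finset.set0Pn; exists false; rewrite inE.
rewrite (_ : ([set: bool]%SET == finset.set0) = false); last first.
  by apply/negbTE/finset.set0Pn; exists false; rewrite inE.
by rewrite !mulr0 addr0.
Qed.

Lemma escape_permission_enabled (p : R) (p01 : 0 <= p <= 1) (s : unit)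
    (B : {set bool}) : ~~ (B \subset enabled (inl s : state escape_game)) ->
  mix_fdist p01 [set false]%SET [set: bool]%SET B = 0.
Proof. by case: s; rewrite sub_enabled_home. Qed.

(** Realises every penalty [p] in the unit interval. *)
Definition escape_permission (p : R) (p01 : 0 <= p <= 1) :
    multi_strategy R escape_game :=
  @MultiStrategy R escape_game
    (fun=> mix_fdist p01 [set false]%SET [set: bool]%SET)
    (escape_permission0 p01) (escape_permission_enabled p01).

Lemma escape_permission_leave (p : R) (p01 : 0 <= p <= 1) :
  escape_permission p01 tt [set false]%SET = p.
Proof.
rewrite /= eqxx mulr1 (_ : (_ == _) = false) ?mulr0 ?addr0 //.
by apply/eqP => /finset.setP/(_ true); rewrite !inE.
Qed.

End escape_permissions.

(* The existence of a sound multi-strategy excludes the degenerate reading where the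
   infimum is taken over the empty set. *)
Theorem theorem3p10 (R : realType) :
  exists (G : stochastic_game) (phi : property G) (psi : penalty_scheme G),
    admissible R phi /\
    (exists theta : multi_strategy R G, sound phi theta) /\
    ~ (exists theta : multi_strategy R G, optimally_permissive phi psi theta).
Proof.
exists escape_game, almost_sure_goal, stay_penalty; split=> //; split.
  have p01 : 0 <= (1 : R) <= 1 by rewrite ler01 lexx.
  exists (escape_permission p01); apply: sound_escape.
  by rewrite escape_permission_leave.
case=> theta [sound_theta].
rewrite pen_sta_escape => inf_leave.
have leave_gt0 : 0 < theta tt [set false]%SET.
  rewrite lt_def fdist_ge0 andbT; apply/eqP => leave0.
  exact: unsound_escape leave0 sound_theta.
(* Halving the positive penalty of an alleged optimum gives a penalty that is still positive, hence
   attained by a sound multi-strategy, and strictly smaller. *)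
have [leave_le1 half_gt0] : theta tt [set false]%SET <= 1 /\
    0 < theta tt [set false]%SET / 2.
  split; last by rewrite divr_gt0.
  rewrite -(fdist_sum1 (theta tt)) (bigD1 [set false]%SET) //= lerDl.
  by apply: sumr_ge0 => B _; exact: fdist_ge0.
have p01 : 0 <= theta tt [set false]%SET / 2 <= 1.
  rewrite ltW //= ler_pdivrMr // mul1r (le_trans leave_le1) //.
  by rewrite ler1n.
have : theta tt [set false]%SET <= theta tt [set false]%SET / 2.
  rewrite [leLHS]inf_leave; apply: ge_inf.
    (* The infimum bounds the penalties from below only once the set has a lower bound, here 0. *)
    by exists 0 => _ [theta' _ <-]; rewrite pen_sta_escape fdist_ge0.
  exists (escape_permission p01).
    by apply: sound_escape; rewrite escape_permission_leave.
  by rewrite pen_sta_escape escape_permission_leave.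
by rewrite leNgt ltr_pdivrMr // ltr_pMr // ltr1n.
Qed.
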